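(* Let $K\ge1$, $N=K+1$, $\theta_j=\frac{\pi j}{K+2}$ for $j=1,\dots,N$, let $M_K$ be the barrier operator on $\mathbb{R}^{2N}$ (defined in the context) with resolvent $L$, let $$\Lambda_K=\sum_{j=1}^{N}\csc\theta_j,\qquad a_j^2=\frac{\csc\theta_j}{\Lambda_K}\quad(a_j>0),$$ and let $y_0^\star\in\mathbb{R}^{2N}$ have norm $a_j$ on block $j$ (so $\|y_0^\star\|=1=d_0$). Then: (i) For every real polynomial $Q$ with $Q(1)=1$ and $\deg Q\le K$, $$\|(L-I)Q(L)y_0^\star\|\ \ge\ \frac1{\Lambda_K}.$$ Hence every method in $\mathcal{A}_\infty$ started at $y_0^\star$ satisfies $\|r(y_K)\|\ge 1/\Lambda_K$ on this instance. (ii) There is a real polynomial $\bar Q$ with $\deg\bar Q\le K$ and $\bar Q(1)=1$ attaining equality in (i); the instance minimax value (the minimum of $\|(L-I)Q(L)y_0^\star\|$ over such polynomials) equals $1/\Lambda_K$. (iii) As $K\to\infty$, $$\Lambda_K=\Big(\frac2\pi+o(1)\Big)K\log K,\qquad\text{so}\qquad \|r(y_K)\|\ \ge\ \Big(\frac\pi2+o(1)\Big)\frac{d_0}{K\log K}$$ for every method in $\mathcal{A}_\infty$ on the instance $(M_K,y_0^\star)$.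
   Context: Barrier operator: with $\omega=e^{2\pi i/(K+2)}$, $M_K$ on $\mathbb{R}^{2N}=(\mathbb{R}^2)^N$ is the direct sum of the skew-symmetric blocks $x\mapsto\tan\theta_j\begin{pmatrix}0&-1\\1&0\end{pmatrix}x$, $j=1,\dots,N$; a block with $\theta_j=\pi/2$ (occurring when $K$ is even) is by convention the normal cone operator of $\{0\}\subset\mathbb{R}^2$, whose resolvent is $0$. The resolvent $L=(I+M_K)^{-1}$ has eigenvalues $\zeta_j=\cos\theta_j\,e^{i\theta_j}=\frac{1+\omega^j}2$, $j=1,\dots,N$, each with multiplicity two, and $|\zeta_j-1|=\sin\theta_j$. The only zero of $M_K$ is $0$, and $d_0$ is the distance from the starting point to the zero set. For an operator with resolvent $J$, $r(y)=J(y)-y$. Class $\mathcal{A}_\infty$: a method which from $y_0$ performs at each iteration $k=0,1,2,\dots$ exactly one resolvent evaluation $x_k=J(v_k)$ at a query point $v_k$ in the affine hull of $\{y_0,x_0,\dots,x_{k-1}\}$ and then chooses $y_{k+1}$ in the affine hull of $\{y_0,x_0,\dots,x_k\}$, all (real, sum-one) coefficients being allowed to depend arbitrarily on everything observed so far. *)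

(* Defs.v *)
From HB Require Import structures.
From mathcomp Require Import all_boot all_order all_algebra.
From mathcomp Require Import all_classical all_reals all_analysis.
From mathcomp Require Import ring.
Set Implicit Arguments.
Unset Strict Implicit.
Unset Printing Implicit Defensive.
Import Order.TTheory GRing.Theory Num.Theory.
Import numFieldNormedType.Exports.
Local Open Scope classical_set_scope.
Local Open Scope ring_scope.

Section Euclidean.
Variables (R : realType) (m n : nat).
Implicit Types x y : 'M[R]_(m, n).

Definition dotp x y : R := \sum_i \sum_j x i j * y i j.

(* The library norm on matrices is the sup norm, hence this definition. *)
Definition enorm x : R := Num.sqrt (dotp x x).

End Euclidean.

Section Operators.
Variables (R : realType) (m n : nat).
Local Notation E := 'M[R]_(m, n).
Implicit Types (A : E -> set E) (C : set E).

Definition normal_cone C : E -> set E :=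
  fun x => [set u | C x /\ forall z, C z -> dotp u (z - x) <= 0].

(* (I + A)^-1: the point p with v \in p + A p.  The value 0 is used only when
   there is no such p, which does not happen for the operator below
   (barrier_resolventP). *)
Definition resolvent A (v : E) : E := xget 0 [set p | A p (v - p)].

Definition residual A (y : E) : E := resolvent A y - y.

Definition zeros A : set E := [set z | A z 0].

Definition dist_zeros A (y : E) : R := inf [set enorm (y - z) | z in zeros A].

End Operators.

Section PolynomialOfOperator.
Variables (R : realType) (V : lmodType R).

Definition poly_op (Q : {poly R}) (f : V -> V) (y : V) : V :=
  \sum_(i < size Q) Q`_i *: iter i f y.

End PolynomialOfOperator.

Section Methods.
Variables (R : realType) (V : lmodType R).

Definition comb n (c : 'I_n -> R) (h : n.-tuple V) : V :=
  \sum_(i < n) c i *: tnth h i.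

(* A method on V.  After k resolvent evaluations the record of observations is
   the tuple (y_0, x_0, ..., x_{k-1}); the query points v_k and the iterates y_k
   are functions of it, so the coefficients need not take them as arguments. *)
Structure method := Method {
  query_coef : forall k, k.+1.-tuple V -> 'I_k.+1 -> R;
  output_coef : forall k, k.+2.-tuple V -> 'I_k.+2 -> R;
  query_coef_sum : forall k (h : k.+1.-tuple V), \sum_i query_coef h i = 1;
  output_coef_sum : forall k (h : k.+2.-tuple V), \sum_i output_coef h i = 1
}.

Variables (M : method) (J : V -> V) (y0 : V).

Definition query k (h : k.+1.-tuple V) : V := comb (query_coef M h) h.

Fixpoint history k : k.+1.-tuple V :=
  match k with
  | 0 => [tuple y0]
  | k'.+1 => [tuple of rcons (history k') (J (query (history k')))]
  end.

Definition iterate k : V :=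
  match k with
  | 0 => y0
  | k'.+1 => comb (output_coef M (history k'.+1)) (history k'.+1)
  end.

End Methods.

Section Barrier.
Variable R : realType.

Definition csc (t : R) : R := (sin t)^-1.

(* j : 'I_K.+1 stands for the index j + 1 in {1, ..., N}, N = K + 1. *)
Definition theta (K : nat) (j : 'I_K.+1) : R := pi * j.+1%:R / (K + 2)%:R.

Definition rot90 : 'M[R]_2 := delta_mx 1 0 - delta_mx 0 1.

Definition barrier_block (t : R) : 'cV[R]_2 -> set 'cV[R]_2 :=
  if t == pi / 2 then normal_cone [set 0]
  else fun x => [set tan t *: (rot90 *m x)].

(* R^(2N) = (R^2)^N is 'M[R]_(2, N): the blocks are the columns. *)
Definition barrier (K : nat) : 'M[R]_(2, K.+1) -> set 'M[R]_(2, K.+1) :=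
  fun x => [set u | forall j, barrier_block (theta j) (col j x) (col j u)].

Definition Lambda (K : nat) : R := \sum_(j < K.+1) csc (theta j).

Definition weight (K : nat) (j : 'I_K.+1) : R :=
  Num.sqrt (csc (theta j) / Lambda K).

Definition hard_start (K : nat) (y0 : 'M[R]_(2, K.+1)) : Prop :=
  forall j, enorm (col j y0) = weight j.

Definition poly_residual (K : nat) (y : 'M[R]_(2, K.+1)) (Q : {poly R}) : R :=
  let L := resolvent (@barrier K) in
  enorm (L (poly_op Q L y) - poly_op Q L y).

Definition admissible (K : nat) : set {poly R} :=
  [set Q : {poly R} | (size Q <= K.+1)%N /\ Q.[1] = 1].

Definition is_minimum (S : set R) (a : R) : Prop := S a /\ lbound S a.

End Barrier.
Arguments barrier : clear implicits.
Arguments Lambda : clear implicits.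
Arguments admissible : clear implicits.

Section BarrierResolvent.
Variable R : realType.

Lemma theta_gt0 K (j : 'I_K.+1) : 0 < theta R j.
Proof. by rewrite /theta divr_gt0 ?mulr_gt0 ?pi_gt0 ?ltr0n // addn2. Qed.

Lemma theta_ltpi K (j : 'I_K.+1) : theta R j < pi.
Proof.
rewrite /theta ltr_pdivrMr ?ltr0n ?addn2 // ltr_pM2l ?pi_gt0 // ltr_nat.
by rewrite ltnS.
Qed.

Lemma cos_neq0_in (t : R) : 0 < t -> t < pi -> t != pi / 2 -> cos t != 0.
Proof.
move=> t0 tpi; apply: contra => /eqP ct.
apply/eqP; apply: cos_inj.
- by rewrite in_itv /= (ltW t0) (ltW tpi).
- rewrite in_itv /= divr_ge0 ?pi_ge0 //= ler_pdivrMr //.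
  by rewrite ler_peMr ?pi_ge0 // ler1n.
- by rewrite ct cos_pihalf.
Qed.

Lemma rot90_sq n (x : 'M[R]_(2, n)) : rot90 R *m (rot90 R *m x) = - x.
Proof.
rewrite mulmxA -[in RHS](mul1mx x) -mulNmx; congr (_ *m _).
apply/matrixP => i k; rewrite !mxE !big_ord_recl big_ord0 !mxE.
by case: i k => [[|[|//]] hi] [[|[|//]] hk]; rewrite -?val_eqE /=; ring.
Qed.

Lemma barrier_blockP (t : R) (v p : 'cV[R]_2) : 0 < t -> t < pi ->
  barrier_block t p (v - p) <->
  p = (cos t ^+ 2) *: v - (cos t * sin t) *: (rot90 R *m v).
Proof.
move=> t0 tpi; rewrite /barrier_block; case: (eqVneq t (pi / 2)) => [->|tn].
  rewrite cos_pihalf expr0n mul0r !scale0r subr0; split => [[]//|->].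
  split => // z ->; rewrite subrr /dotp big1 // => i _; rewrite big1 // => k _.
  by rewrite [X in _ * X]mxE mulr0.
have c0 := cos_neq0_in t0 tpi tn.
have cs : cos t ^+ 2 + sin t ^+ 2 = 1 by exact: cos2Dsin2.
split => /= [/eqP|->].
  rewrite subr_eq => /eqP ->; rewrite mulmxDr -scalemxAr rot90_sq.
  move: (rot90 R *m p) => w; apply/matrixP => i k; rewrite !mxE /tan.
  by rewrite -[LHS]mul1r -cs; field.
rewrite mulmxBr -!scalemxAr rot90_sq.
move: (rot90 R *m v) => w; apply/matrixP => i k; rewrite !mxE /tan.
by rewrite -{1}[v i k]mul1r -cs; field.
Qed.

Lemma barrier_resolventP K (v p : 'M[R]_(2, K.+1)) :
  barrier R K p (v - p) <-> p = resolvent (barrier R K) v.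
Proof.
pose q : 'M[R]_(2, K.+1) := \matrix_(i, j)
  ((cos (theta R j) ^+ 2) *: col j v
   - (cos (theta R j) * sin (theta R j)) *: (rot90 R *m col j v)) i 0.
have colq j : col j q = (cos (theta R j) ^+ 2) *: col j v
   - (cos (theta R j) * sin (theta R j)) *: (rot90 R *m col j v).
  by apply/colP => i; rewrite !mxE.
have spec u : barrier R K u (v - u) <-> u = q.
  have colE j : col j (v - u) = col j v - col j u by rewrite linearB.
  split => [bu|-> j].
    apply/matrixP => i j; have := bu j.
    rewrite colE => /(barrier_blockP (col j v) (col j u) (theta_gt0 j) (theta_ltpi j)).
    by rewrite -colq => /colP/(_ i); rewrite !mxE.
  rewrite linearB.
  apply/(barrier_blockP (col j v) (col j q) (theta_gt0 j) (theta_ltpi j)).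
  exact: colq.
have rq : resolvent (barrier R K) v = q.
  have ex : exists u, [set u | barrier R K u (v - u)] u.
    by exists q; apply/spec.
  by apply/spec; exact: (xgetPex 0 ex).
by rewrite rq; exact: spec.
Qed.

End BarrierResolvent.

(* Main.v *)
(* In the complex coordinate of each block the resolvent L is multiplication by
   zeta_j = (1 + w^j) / 2, where w is a primitive n-th root of unity, n = K + 2.
   Put P(z) = Q((1 + z) / 2).  As deg P <= K = n - 2, the coefficient of z^(n-1)
   vanishes, i.e. sum_j w^j P(w^j) = 0 over all n-th roots of unity; with
   P(1) = 1 this gives 1 <= sum_(j > 0) |P(w^j)|, while the squared residual is
   Lambda^-1 sum_(j > 0) sin(theta_j) |P(w^j)|^2, so Cauchy-Schwarz yields
   1 / Lambda.  Equality holds when P interpolates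
   P(w^j) = - w^(-j) csc(theta_j) / Lambda, and the symmetry j -> n - j makes
   this P real.  The asymptotics of Lambda compare csc t with
   1 / t + 1 / (pi - t), which it approximates within 1, turning Lambda into a
   harmonic sum. *)
Require Import Defs.
From HB Require Import structures.
From mathcomp Require Import all_boot all_order all_algebra.
From mathcomp Require Import all_classical all_reals all_analysis.
From mathcomp Require Import complex ring lra zify.
Set Implicit Arguments.
Unset Strict Implicit.
Unset Printing Implicit Defensive.
Import Order.TTheory GRing.Theory Num.Theory.
Import numFieldNormedType.Exports.
Local Open Scope classical_set_scope.
Local Open Scope ring_scope.

(** * Growth of [Lambda]: cosecants against reciprocals, then harmonic sums against logarithms *)

Section Asymptotics.
Variable R : realType.

(** By the mean value theorem sin x = x cos c with 0 < c < x, and the cosine decreases on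
    [0, pi]. *)
Lemma sin_bounds (x : R) : 0 < x < pi -> x * cos x <= sin x <= x.
Proof.
move=> /andP[x0 xpi].
have [|c] := @MVT R sin cos 0 x x0 (fun y _ => is_derive_sin y).
  exact/continuous_subspaceT/continuous_sin.
rewrite in_itv /= sin0 !subr0 => /andP[c0 cx] ->.
have xI : x \in `[0, pi] by rewrite in_itv /= !ltW.
have cI : c \in `[0, pi] by rewrite in_itv /= !ltW // (lt_trans cx).
rewrite mulrC ler_pM2r // ger_pMl // cos_le1 andbT ltW //.
by rewrite (ltr_cos cI xI).
Qed.

Lemma csc_inv_bounds (x : R) : 0 < x <= pi / 2 -> 0 <= csc x - x^-1 <= 1.
Proof.
move=> /andP[x0 xpi2].
have xpi : x < pi by apply: (le_lt_trans xpi2); have := @pi_gt0 R; lra.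
have s0 : 0 < sin x by rewrite sin_gt0_pi // x0.
have c0 : 0 <= cos x by rewrite cos_ge0_pihalf // xpi2 andbT; lra.
have /andP[hl hu] : x * cos x <= sin x <= x by apply: sin_bounds; rewrite x0.
rewrite /csc subr_ge0 lef_pV2 ?posrE // hu /=.
have h : cos x / sin x <= x^-1 by rewrite ler_pdivrMr // ler_pdivlMl.
(* What remains is 1 - cos x <= sin x, which follows from cos^2 + sin^2 = 1 as both are nonnegative
   here. *)
suff : (sin x)^-1 - cos x / sin x <= 1 by lra.
rewrite -[X in X - _]mul1r -mulrBl ler_pdivrMr // mul1r.
have := cos2Dsin2 x; nra.
Qed.

(** For x <= pi / 2 the error is (csc x - 1 / x) - 1 / (pi - x), a difference of two numbers of
    [0, 1]; the reflection x -> pi - x gives the other half. *)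
Lemma csc_expansion (x : R) : 0 < x < pi ->
  `|csc x - (x^-1 + (pi - x)^-1)| <= 1.
Proof.
wlog xpi2 : x / x <= pi / 2 => [hw /andP[x0 xpi]|/andP[x0 xpi]].
  have [h|h] := leP x (pi / 2); first by apply: hw; rewrite ?x0.
  have : `|csc (pi - x) - ((pi - x)^-1 + (pi - (pi - x))^-1)| <= 1.
    by apply: hw; [lra | apply/andP; split; lra].
  rewrite subKr [X in _ - X]addrC.
  rewrite {1}/csc sinB sinpi cospi mul0r sub0r mulN1r opprK; exact.
have /andP[h1 h2] : 0 <= csc x - x^-1 <= 1 by apply: csc_inv_bounds; rewrite x0.
have p2 := @pihalf_ge1 R.
have h3 : 0 < (pi - x)^-1 by rewrite invr_gt0; lra.
have h4 : (pi - x)^-1 <= 1 by rewrite invf_le1; lra.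
by rewrite ler_norml; apply/andP; split; lra.
Qed.

(** Both bounds are ln (1 + u) <= u, at u = 1 / (m + 1) and at u = - 1 / (m + 2); the two values of
    1 + u are inverse to each other. *)
Lemma ln_succ_bounds m :
  m.+2%:R^-1 <= ln m.+2%:R - ln m.+1%:R :> R
  /\ ln m.+2%:R - ln m.+1%:R <= m.+1%:R^-1 :> R.
Proof.
have step : ln m.+2%:R - ln m.+1%:R = ln (1 + m.+1%:R^-1) :> R.
  rewrite -ln_div ?posrE ?ltr0n // -addn1 natrD mulrDl divff ?pnatr_eq0 //.
  by rewrite mul1r.
have hu : ln (1 + m.+1%:R^-1) <= m.+1%:R^-1 :> R.
  by apply: le_ln1Dx; apply: lt_trans (_ : 0 < _); rewrite ?ltrN10 //
    invr_gt0 ltr0n.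
have hl : ln (1 - m.+2%:R^-1) <= - m.+2%:R^-1 :> R.
  by apply: le_ln1Dx; rewrite ltrN2 invf_lt1 ?ltr0n // ltr1n.
have E : ln (1 - m.+2%:R^-1) = - ln (1 + m.+1%:R^-1) :> R.
  rewrite -lnV ?posrE ?addr_gt0 ?invr_gt0 ?ltr0n //; congr ln.
  rewrite -[m.+2%:R]natr1; have := ltr0Sn R m; move: m.+1%:R => x x0.
  by field; rewrite !lt0r_neq0 // addr_gt0.
by rewrite step; split=> //; rewrite E lerN2 in hl.
Qed.

Lemma harmonic_ln_bounds m :
  ln m.+2%:R <= \sum_(j < m.+1) j.+1%:R^-1 :> R
  /\ \sum_(j < m.+1) j.+1%:R^-1 <= 1 + ln m.+1%:R :> R.
Proof.
elim: m => [|m [IHl IHu]].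
  rewrite big_ord_recl big_ord0 ln1 invr1 !addr0; split=> //.
  by have [_] := ln_succ_bounds 0; rewrite ln1 invr1 subr0.
have [_ h1] := ln_succ_bounds m.+1; have [h2 _] := ln_succ_bounds m.
rewrite lerBlDl in h1; rewrite lerBrDl in h2; rewrite big_ord_recr /=; split.
  by rewrite (le_trans h1) // lerD2r.
by rewrite -(lerD2l 1) in h2; rewrite (le_trans _ h2) // addrA lerD2r.
Qed.

(** Reversing the index turns the sum of 1 / (pi - theta_j) into that of 1 / theta_j, hence the
    factor 2; each of the K + 1 terms has error at most 1. *)
Lemma Lambda_harmonic K :
  `|Lambda R K - 2 / pi * K.+2%:R * \sum_(j < K.+1) j.+1%:R^-1| <= K.+1%:R.
Proof.
have th (j : 'I_K.+1) : theta R j = pi / K.+2%:R * j.+1%:R.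
  by rewrite /theta addn2 mulrAC.
have n0 : (K.+2%:R : R) != 0 by rewrite pnatr_eq0.
have e1 : \sum_(j < K.+1) (theta R j)^-1
    = K.+2%:R / pi * \sum_(j < K.+1) j.+1%:R^-1.
  by rewrite mulr_sumr; apply: eq_bigr => j _; rewrite th invfM invf_div.
have e2 : \sum_(j < K.+1) (pi - theta R j)^-1 = \sum_(j < K.+1) (theta R j)^-1.
  rewrite [LHS](reindex_inj rev_ord_inj) /=; apply: eq_bigr => j _.
  congr _^-1; rewrite !th /= -subSn ?ltn_ord // natrB; last exact/leqW/ltn_ord.
  by rewrite mulrBr divfK // subKr.
have -> : 2 / pi * K.+2%:R * \sum_(j < K.+1) j.+1%:R^-1
    = \sum_(j < K.+1) ((theta R j)^-1 + (pi - theta R j)^-1).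
  rewrite big_split /= e2 e1 -mulrDl; congr (_ * _).
  by rewrite mulrAC mulr2n mulrDl mul1r mulrDl.
rewrite /Lambda -sumrB (le_trans (ler_norm_sum _ _ _)) //.
rewrite -[X in _ <= X%:R]card_ord -sumr_const; apply: ler_sum => j _.
by apply: csc_expansion; rewrite theta_gt0 theta_ltpi.
Qed.

(** With c = 2 / pi <= 1, the error of [Lambda_harmonic], c (K + 2) (H - ln K) and 2 c ln K add up
    to at most (K + 1) + 2 (K + 2) + 2 K = 5 K + 5 <= 8 K. *)
Lemma Lambda_KlnK K : (2 <= K)%N ->
  `|Lambda R K - 2 / pi * (K%:R * ln K%:R)| <= 8 * K%:R.
Proof.
move=> K2; have K0 : (0 < K)%N by exact: ltnW.
have Kr : 2 <= K%:R :> R by rewrite ler_nat.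
have := Lambda_harmonic K; set H := \sum_(_ < _) _ => hL.
have hH : ln K%:R <= H <= 2 + ln K%:R.
  have [h1 h2] := harmonic_ln_bounds K.
  have [_ h3] := ln_succ_bounds K.
  have [_ h4] := ln_succ_bounds K.-1.
  have h5 : ln K%:R <= ln K.+2%:R :> R.
    by rewrite ler_ln ?posrE ?ltr0n ?ler_nat // -addn2 leq_addr.
  have h6 : K%:R^-1 <= 1 :> R by rewrite invf_le1; lra.
  rewrite prednK // in h4.
  by rewrite -/H in h1 h2; apply/andP; split; lra.
have l0 : 0 <= ln K%:R :> R by rewrite ln_ge0; lra.
have lK : ln K%:R <= K%:R :> R by rewrite ltW // ln_sublinear; lra.
have p2 : 0 < (2 / pi : R) <= 1.
  have := @pi_ge2 R => pi2; rewrite divr_gt0 //=; last by lra.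
  by rewrite ler_pdivrMr; lra.
move: hL; rewrite -[K.+1%:R]natr1 -[K.+2%:R]natr1 -[K.+1%:R]natr1.
clearbody H; move: p2 hH l0 lK Kr.
move: (2 / pi : R) (K%:R : R) (ln K%:R : R) => c k l.
move=> /andP[c0 c1] /andP[H1 H2] l0 lk k2.
rewrite !ler_norml => /andP[L1 L2].
have P1 : 0 <= c * (k + 1 + 1) * (H - l) <= 2 * (k + 1 + 1).
  apply/andP; split; first by do 2?apply: mulr_ge0; lra.
  have -> : 2 * (k + 1 + 1) = 1 * (k + 1 + 1) * 2 by ring.
  by rewrite ler_pM ?mulr_ge0 ?ler_wpM2r //; lra.
have P2 : 0 <= c * l <= k.
  apply/andP; split; first by rewrite mulr_ge0 //; lra.
  by rewrite -[k]mul1r ler_pM //; lra.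
case/andP: P1 => P1 P1'; case/andP: P2 => P2 P2'.
by apply/andP; split; nra.
Qed.

Lemma cvg_Lambda_ratio :
  (fun K => Lambda R K / (K%:R * ln K%:R)) @ \oo --> (2 / pi : R).
Proof.
apply/cvgrPdist_le => e e0; near=> K.
have K2 : (2 <= K)%N by near: K; exact: nbhs_infty_ge.
have K0 : 0 < K%:R :> R by rewrite ltr0n ltnW.
(* Beyond this threshold the error 8 K is at most e K ln K. *)
have lK : 8 / e <= ln K%:R.
  rewrite -ler_expR lnK ?posrE // ltW //.
  by near: K; exact: nbhs_infty_gtr.
have l0 : 0 < ln K%:R :> R by rewrite (lt_le_trans _ lK) // divr_gt0.
rewrite distrC -[2 / pi](@mulfK _ (K%:R * ln K%:R)); last first.
  by rewrite gt_eqF // mulr_gt0.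
rewrite -mulrBl normrM normfV (@gtr0_norm _ (K%:R * ln K%:R)) ?mulr_gt0 //.
rewrite ler_pdivrMr ?mulr_gt0 // (le_trans (Lambda_KlnK K2)) //.
rewrite mulrCA [X in X <= _]mulrC ler_pM2l //.
by rewrite ler_pdivrMr // mulrC in lK.
Unshelve. all: by end_near.
Qed.

End Asymptotics.

Section ComplexCoordinates.
Import ComplexField.Normc.
Local Open Scope complex_scope.

(** * Orthogonality of the powers of a primitive root of unity *)

Section RootsOfUnity.
Variables (F : fieldType) (n : nat) (w : F).
Hypothesis w_prim : n.-primitive_root w.

Lemma sum_prim_root_expr m :
  \sum_(j < n) w ^+ (j * m) = if (n %| m)%N then n%:R else 0.
Proof.
have wm j : w ^+ (j * m) = (w ^+ m) ^+ j by rewrite mulnC exprM.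
under eq_bigr do rewrite wm.
case: ifPn => [/dvdnP[q ->]|nm].
  under eq_bigr do rewrite mulnC exprM (prim_expr_order w_prim) !expr1n.
  by rewrite sumr_const card_ord.
have wm1 : w ^+ m - 1 != 0 by rewrite subr_eq0 -(prim_order_dvd w_prim).
(* The geometric sum times w^m - 1 telescopes to w^(m n) - 1 = 0. *)
apply: (mulfI wm1); rewrite mulr0 -subrX1 -exprM mulnC exprM.
by rewrite (prim_expr_order w_prim) expr1n subrr.
Qed.

(* Up to the factor n the sum is the coefficient of 'X^n.-1. *)
Lemma sum_prim_root_horner (P : {poly F}) : (size P < n)%N ->
  \sum_(j < n) w ^+ j * P.[w ^+ j] = 0.
Proof.
move=> sP; under eq_bigr do rewrite horner_coef mulr_sumr.
rewrite exchange_big big1 //= => m _.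
under eq_bigr => j _ do rewrite mulrCA -exprM -exprD -mulnS.
rewrite -mulr_sumr sum_prim_root_expr gtnNdvd ?mulr0 //.
exact: leq_ltn_trans sP.
Qed.

End RootsOfUnity.

(** * Polynomials under an affine change of variable *)

Section AffineComposition.
Variable F : idomainType.
Implicit Types (p : {poly F}) (a b z : F).

Lemma size_comp_affine p a b : a != 0 ->
  size (p \Po (a%:P * 'X + b%:P)) = size p.
Proof.
move=> a0; rewrite size_comp_poly2 // size_MXaddC polyC_eq0 (negbTE a0) /=.
by rewrite size_polyC a0.
Qed.

Lemma horner_comp_affine p a b z :
  (p \Po (a%:P * 'X + b%:P)).[z] = p.[a * z + b].
Proof. by rewrite horner_comp hornerD hornerM !hornerC hornerX. Qed.

End AffineComposition.

(** * The unit circle in real trigonometric form *)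

Section UnitCircle.
Variable R : realType.
Implicit Types t : R.

Definition cis t : R[i] := cos t +i* sin t.

Lemma cis0 : cis 0 = 1.
Proof. by rewrite /cis cos0 sin0. Qed.

Lemma cisD x y : cis (x + y) = cis x * cis y.
Proof.
by rewrite /cis cosD sinD; apply/eqP; rewrite eq_complex /= addrC eqxx /=;
   apply/eqP; ring.
Qed.

Lemma cisX t k : cis t ^+ k = cis (t *+ k).
Proof.
elim: k => [|k IH]; first by rewrite expr0 mulr0n cis0.
by rewrite exprS mulrS cisD IH.
Qed.

Lemma normc_cis t : normc (cis t) = 1.
Proof. by rewrite /normc /= cos2Dsin2 sqrtr1. Qed.

Lemma cis2pi : cis (pi *+ 2) = 1.
Proof. by rewrite /cis cos2pi sin2pi. Qed.

Lemma cos_sin_2pin k :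
  cos (pi *+ 2 *+ k) = 1 :> R /\ sin (pi *+ 2 *+ k) = 0 :> R.
Proof.
have := cisX (pi *+ 2) k; rewrite cis2pi expr1n /cis.
by move=> /esym/eqP; rewrite eq_complex /= => /andP[/eqP-> /eqP->].
Qed.

Lemma cisE t : cis t = (cos t)%:C + 'i%C * (sin t)%:C.
Proof. by rewrite [LHS]complexE. Qed.

(** Half-angle factorisation, which yields zeta_j = cos theta_j e^(i theta_j). *)
Lemma cis_double t : 1 + cis (t *+ 2) = 2 * (cos t)%:C * cis t.
Proof.
rewrite /cis cos_mulr2n sin_mulr2n.
apply/eqP; rewrite eq_complex /=; apply/andP; split; apply/eqP; ring.
Qed.

Lemma cis_neq1 t : 0 < t < pi -> cis (t *+ 2) != 1.
Proof.
move=> /sin_gt0_pi s0; apply/eqP => /(congr1 (@complex.Re R)) /=.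
rewrite cos_mulr2n cos2sin2 => h; have : sin t ^+ 2 = 0 by lra.
by move/eqP; rewrite sqrf_eq0 gt_eqF.
Qed.

End UnitCircle.

(** * The root w = e^(2 pi i / (K + 2)) and the angles theta_j *)

Section Omega.
Variables (R : realType) (K : nat).
Local Notation N := K.+1.
Local Notation n := K.+2.
Implicit Types j : 'I_N.

Definition omega : R[i] := cis (pi / n%:R *+ 2).

Lemma thetaE j : theta R j = (pi / n%:R) *+ j.+1.
Proof. by rewrite /theta addn2 mulrAC mulr_natr. Qed.

Lemma omegaX j : omega ^+ j.+1 = cis (theta R j *+ 2).
Proof. by rewrite /omega cisX thetaE -!mulrnA mulnC. Qed.

Lemma omega_prim : n.-primitive_root omega.
Proof.
apply/andP; split=> //; apply/forallP => i; apply/eqP.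
(* The power i + 1 must be 1 only for i + 1 = n; a smaller exponent gives the angle 2 theta with 0 <
   theta < pi. *)
rewrite unity_rootE; case: (ltnP i n.-1) => /= iN.
  rewrite (omegaX (Ordinal iN)) eqSS ltn_eqF //.
  by apply/negbTE; apply: cis_neq1; rewrite theta_gt0 theta_ltpi.
have -> : (i : nat) = K.+1 by apply/eqP; rewrite eqn_leq iN -ltnS ltn_ord.
rewrite /= eqxx /omega cisX -mulrnA mulnC mulrnA -[_ *+ n]mulr_natr divfK.
  by rewrite cis2pi !eqxx.
by rewrite pnatr_eq0.
Qed.

(** As ordinals are shifted by one, [rev_ord] is the reflection j -> n - j, that is, conjugation of
    w^j. *)
Lemma rev_theta j : theta R (rev_ord j) = pi - theta R j.
Proof.
rewrite !thetaE /= -subSn ?ltn_ord // mulrnBr; last exact/leqW/ltn_ord.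
by rewrite -[X in X - _]mulr_natr divfK // pnatr_eq0.
Qed.

End Omega.

(** * The resolvent as a diagonal operator in complex block coordinates *)

Section BarrierCoordinates.
Variables (R : realType) (K : nat).
Local Notation N := K.+1.
Local Notation n := K.+2.
Local Notation E := 'M[R]_(2, N).
Local Notation J := (resolvent (barrier R K)).
Local Notation w := (omega R K).
Local Notation C := (real_complex R).
Implicit Types (x y : E) (j : 'I_N) (Q : {poly R}).

(* The sign makes the resolvent multiplication by zeta rather than by its
   conjugate. *)
Definition zcoord x j : R[i] := x 0 j -i* x 1 j.

Definition zeta j : R[i] := (1 + w ^+ j.+1) / 2.

Lemma zetaE j :
  zeta j = cos (theta R j) ^+ 2 +i* (cos (theta R j) * sin (theta R j)).
Proof.
rewrite /zeta omegaX cis_double mulrAC [2 * _]mulrC mulfK ?pnatr_eq0 //.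
by rewrite /cis; apply/eqP; rewrite eq_complex /= !mul0r subr0 addr0 expr2 !eqxx.
Qed.

Lemma normc_zetaB1 j : normc (zeta j - 1) = sin (theta R j).
Proof.
have s0 : 0 <= sin (theta R j).
  by rewrite ltW // sin_gt0_pi // theta_gt0 theta_ltpi.
rewrite zetaE /normc /= -[RHS](ger0_norm s0) -sqrtr_sqr; congr Num.sqrt.
have := cos2Dsin2 (theta R j); move: (cos _) (sin _) => c s cs.
have c2 : c ^+ 2 = 1 - s ^+ 2 by rewrite -cs addrK.
transitivity ((c ^+ 2 - 1) ^+ 2 + c ^+ 2 * s ^+ 2); first by ring.
by rewrite c2; ring.
Qed.

Lemma zcoordD x y j : zcoord (x + y) j = zcoord x j + zcoord y j.
Proof. by rewrite /zcoord !mxE opprD. Qed.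

Lemma zcoordZ a x j : zcoord (a *: x) j = C a * zcoord x j.
Proof.
rewrite /zcoord !mxE; apply/eqP.
by rewrite eq_complex /= !mul0r subr0 addr0 mulrN !eqxx.
Qed.

Lemma zcoordB x y j : zcoord (x - y) j = zcoord x j - zcoord y j.
Proof. by rewrite /zcoord !mxE opprD. Qed.

Lemma zcoord_sum (I : finType) (f : I -> E) j :
  zcoord (\sum_i f i) j = \sum_i zcoord (f i) j.
Proof.
apply: (big_morph (zcoord^~ j)) => [x y|]; first exact: zcoordD.
by rewrite /zcoord !mxE oppr0.
Qed.

Lemma zcoord_inj x y : zcoord x =1 zcoord y -> x = y.
Proof.
move=> xy; apply/matrixP => i j; case: (xy j) => e0 /oppr_inj e1.
by case: i => [[|[|//]] hi]; [move: e0|move: e1]; congr (_ = _); congr (_ _ j);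
  apply: val_inj.
Qed.

Lemma enorm_col x j : enorm (col j x) = normc (zcoord x j).
Proof.
rewrite /enorm /dotp /normc /=; congr Num.sqrt.
rewrite !big_ord_recl !big_ord0 !addr0 !mxE sqrrN !expr2.
by congr (_ + x _ _ * x _ _); apply: val_inj.
Qed.

Lemma enorm_sqr x : enorm x ^+ 2 = \sum_j normc (zcoord x j) ^+ 2.
Proof.
rewrite sqr_sqrtr; last first.
  by apply: sumr_ge0 => i _; apply: sumr_ge0 => j _; rewrite -expr2 sqr_ge0.
rewrite /dotp exchange_big; apply: eq_bigr => j _ /=.
rewrite /normc /= sqr_sqrtr ?addr_ge0 ?sqr_ge0 // sqrrN !expr2.
rewrite !big_ord_recl big_ord0 addr0.
by congr (_ + x _ _ * x _ _); apply: val_inj.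
Qed.

(** In the coordinate x_0 - i x_1, [rot90] is multiplication by -i, so the formula of
    [barrier_blockP] becomes the factor cos^2 + i cos sin = zeta_j. *)
Lemma zcoord_resolvent x j : zcoord (J x) j = zeta j * zcoord x j.
Proof.
have := (barrier_resolventP x (J x)).2 erefl j.
rewrite linearB => /(barrier_blockP _ _ (theta_gt0 R j) (theta_ltpi R j)) /colP e.
rewrite zetaE /zcoord; apply/eqP; rewrite eq_complex /=.
have := e 0; have := e 1; rewrite !mxE !big_ord_recl !big_ord0 !mxE /= => -> ->.
have -> : lift ord0 ord0 = 1 :> 'I_2 by apply: val_inj.
by apply/andP; split; apply/eqP; ring.
Qed.

Lemma zcoord_poly_op Q x j :
  zcoord (poly_op Q J x) j = (map_poly C Q).[zeta j] * zcoord x j.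
Proof.
rewrite /poly_op zcoord_sum horner_coef size_map_poly mulr_suml.
apply: eq_bigr => i _; rewrite zcoordZ coef_map -mulrA; congr (_ * _).
elim: (i : nat) => [|k IH]; first by rewrite expr0 mul1r.
by rewrite iterS zcoord_resolvent IH exprS mulrA.
Qed.

(** A zero is a fixed point of the resolvent, and zeta_j differs from 1 because |zeta_j - 1| = sin
    theta_j > 0. *)
Lemma zeros_barrier : zeros (barrier R K) = [set 0].
Proof.
apply/seteqP; split => x /=; rewrite /zeros /=; last first.
  move=> ->; rewrite -[X in barrier R K _ X](subr0 0).
  apply/barrier_resolventP/zcoord_inj => j; rewrite zcoord_resolvent.
  by rewrite /zcoord !mxE oppr0 mulr0.
rewrite -[X in barrier R K _ X](subrr x) => /barrier_resolventP e.
apply: zcoord_inj => j; have := zcoord_resolvent x j; rewrite -e.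
move/eqP; rewrite -subr_eq0 -[X in X - _]mul1r -mulrBl mulf_eq0 => /orP[].
  rewrite subr_eq0 eq_sym -subr_eq0 => /eqP h; have := normc_zetaB1 j.
  rewrite h normc0 => /esym/eqP; rewrite gt_eqF // sin_gt0_pi //.
  by rewrite theta_gt0 theta_ltpi.
by move/eqP->; rewrite /zcoord !mxE oppr0.
Qed.

End BarrierCoordinates.

(** * The extremal problem: reduction to polynomials, lower bound, equality case *)

Section Minimax.
Variables (R : realType) (K : nat).
Local Notation N := K.+1.
Local Notation n := K.+2.
Local Notation E := 'M[R]_(2, N).
Local Notation J := (resolvent (barrier R K)).
Local Notation w := (omega R K).
Local Notation C := (real_complex R).
Local Notation th := (@theta R K).
Local Notation L := (Lambda R K).
Implicit Types (x y : E) (j : 'I_N) (Q : {poly R}).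

Lemma sin_theta_gt0 j : 0 < sin (th j).
Proof. by rewrite sin_gt0_pi // theta_gt0 theta_ltpi. Qed.

Lemma csc_theta_gt0 j : 0 < csc (th j).
Proof. by rewrite invr_gt0 sin_theta_gt0. Qed.

Lemma Lambda_gt0 : 0 < L.
Proof.
rewrite /Lambda big_ord_recl ltr_wpDr ?csc_theta_gt0 //.
by apply: sumr_ge0 => j _; rewrite ltW // csc_theta_gt0.
Qed.

Lemma csc_rev_ord j : csc (th (rev_ord j)) = csc (th j).
Proof. by rewrite /csc rev_theta sinB sinpi cospi mul0r sub0r mulN1r opprK. Qed.

Lemma weight_sqr j : weight R j ^+ 2 = csc (th j) / L.
Proof. by rewrite sqr_sqrtr // divr_ge0 ?ltW ?csc_theta_gt0 ?Lambda_gt0. Qed.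

Lemma enorm_hard_start y : hard_start y -> enorm y = 1.
Proof.
move=> hy; apply/eqP; rewrite -(@eqrXn2 _ 2) ?sqrtr_ge0 // expr1n enorm_sqr.
under eq_bigr do rewrite -enorm_col hy weight_sqr.
by rewrite -mulr_suml divff // gt_eqF ?Lambda_gt0.
Qed.

Lemma dist_zeros_barrier y : dist_zeros (barrier R K) y = enorm y.
Proof. by rewrite /dist_zeros zeros_barrier image_set1 subr0 inf1. Qed.

(** An affine Krylov set of the resolvent. In coordinates, applying L multiplies Q by ['X]; [d]
    bounds the size, so deg Q < d. *)
Definition krylov (y : E) (d : nat) (x : E) : Prop :=
  exists Q, [/\ (size Q <= d)%N, Q.[1] = 1 &
    forall j, zcoord x j = (map_poly C Q).[zeta R j] * zcoord y j].

Lemma krylov_poly_op y Q : Q.[1] = 1 -> krylov y (size Q) (poly_op Q J y).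
Proof. by exists Q; split=> // j; exact: zcoord_poly_op. Qed.

Lemma krylov_start y d : (0 < d)%N -> krylov y d y.
Proof.
move=> d0; exists 1; split=> [||j]; rewrite ?size_poly1 ?hornerC //.
by rewrite rmorph1 hornerC mul1r.
Qed.

Lemma krylov_leq y d d' x : (d <= d')%N -> krylov y d x -> krylov y d' x.
Proof. by move=> dd [Q [sQ *]]; exists Q; split; rewrite // (leq_trans sQ). Qed.

Lemma krylov_resolvent y d x : krylov y d x -> krylov y d.+1 (J x).
Proof.
move=> [Q [sQ Q1 hQ]]; exists (Q * 'X); split=> [||j].
- by rewrite (leq_trans (size_polyMleq _ _)) // size_polyX addn2.
- by rewrite hornerMX mulr1.
by rewrite zcoord_resolvent hQ rmorphM /= map_polyX hornerMX mulrCA mulrA.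
Qed.

(** Sum-one coefficients preserve Q(1) = 1. They are arbitrary reals here, so an adaptive choice
    gains nothing. *)
Lemma krylov_comb y d k (c : 'I_k -> R) (h : k.-tuple E) :
  \sum_i c i = 1 -> (forall x, x \in h -> krylov y d x) ->
  krylov y d (comb c h).
Proof.
move=> c1 hh; have [f hf] := choice (fun i => hh _ (mem_tnth i h)).
exists (\sum_i c i *: f i); split.
- apply: (big_ind (fun Q : {poly R} => (size Q <= d)%N)) => [|p q|i _].
  + by rewrite size_poly0.
  + by move=> ??; rewrite (leq_trans (size_polyD _ _)) // geq_max; apply/andP.
  + by case: (hf i) => *; rewrite (leq_trans (size_scale_leq _ _)).
- rewrite horner_sum -[RHS]c1; apply: eq_bigr => i _.
  by case: (hf i) => _ Q1 _; rewrite hornerZ Q1 mulr1.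
move=> j; rewrite zcoord_sum rmorph_sum /= horner_sum mulr_suml.
apply: eq_bigr => i _; case: (hf i) => _ _ hQ.
by rewrite zcoordZ hQ map_polyZ hornerZ mulrA.
Qed.

(** Queries are affine combinations and only an evaluation raises the degree, by one, so k
    evaluations give degree at most k. *)
Lemma krylov_history (M : method E) y k x :
  x \in history M J y k -> krylov y k.+1 x.
Proof.
elim: k x => [|k IH] x /=.
  by rewrite inE => /eqP ->; exact: krylov_start.
rewrite mem_rcons inE => /orP[/eqP ->|/IH]; last exact: krylov_leq.
exact/krylov_resolvent/krylov_comb/IH/query_coef_sum.
Qed.

Lemma krylov_iterate (M : method E) y k : krylov y k.+1 (iterate M J y k).
Proof.
case: k => [|k]; first exact: krylov_start.
by apply: krylov_comb; [exact: output_coef_sum | exact: krylov_history].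
Qed.

(** Block j carries the weight |zeta_j - 1|^2 a_j^2 = sin^2 theta_j csc theta_j / Lambda. The
    hypothesis on coordinates covers iterates as well as [poly_op]. *)
Lemma residual_sqr y x Q : hard_start y ->
    (forall j, zcoord x j = (map_poly C Q).[zeta R j] * zcoord y j) ->
  enorm (J x - x) ^+ 2
    = L^-1 * \sum_j sin (th j) * normc (map_poly C Q).[zeta R j] ^+ 2.
Proof.
move=> hy hx; rewrite enorm_sqr mulr_sumr; apply: eq_bigr => j _.
rewrite zcoordB zcoord_resolvent -[X in _ - X]mul1r -mulrBl hx !normcM.
rewrite normc_zetaB1 -enorm_col hy !exprMn weight_sqr /csc.
by have := sin_theta_gt0 j => s0; field; rewrite !gt_eqF // Lambda_gt0.
Qed.

Lemma sum_normc_ge1 Q : (size Q <= K.+1)%N -> Q.[1] = 1 ->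
  1 <= \sum_(j < N) normc (map_poly C Q).[zeta R j].
Proof.
move=> sQ Q1; pose P := map_poly C Q \Po ((2^-1)%:P * 'X + (2^-1)%:P).
have PE z : P.[z] = (map_poly C Q).[(1 + z) / 2].
  by rewrite horner_comp_affine; congr _.[_]; ring.
have sP : (size P < n)%N.
  by rewrite ltnS size_comp_affine ?size_map_poly // invr_eq0 pnatr_eq0.
have := sum_prim_root_horner (omega_prim R K) sP.
(* The term of index 0 is P(1) = Q(1) = 1, so the others sum to -1 and the triangle inequality
   applies. *)
rewrite big_ord_recl expr0 mul1r PE -mulr2n -mulr_natr mul1r divff ?pnatr_eq0 //.
rewrite -(rmorph1 C) horner_map Q1 rmorph1 => /eqP; rewrite addr_eq0 => /eqP e.
rewrite -(@normc1 R) [X in normc X <= _]e normcN.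
apply: (@le_trans _ _ (\sum_(j < N) normc (w ^+ j.+1 * P.[w ^+ j.+1]))).
  elim/big_ind2 : _ => [|a b c d h1 h2|//]; first by rewrite normc0.
  by rewrite (le_trans (le_normcD _ _)) // lerD.
by apply: ler_sum => j _; rewrite normcM omegaX normc_cis mul1r PE -omegaX.
Qed.

Lemma residual_lower_bound y x : hard_start y -> krylov y K.+1 x ->
  1 / L <= enorm (J x - x).
Proof.
move=> hy [Q [sQ Q1 hx]].
pose u j := normc (map_poly C Q).[zeta R j].
have Lp := Lambda_gt0.
have u1 : 1 <= \sum_j u j by exact: sum_normc_ge1.
rewrite -(@ler_pXn2r _ 2) ?nnegrE ?sqrtr_ge0 ?divr_ge0 ?(ltW Lp) //.
rewrite (residual_sqr hy hx) div1r expr2 ler_pM2l ?invr_gt0 //.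
(* Cauchy-Schwarz, as the nonnegativity of the weighted squared distance of u
   to its equality case csc / Lambda. *)
have : 0 <= \sum_j sin (th j) * (u j - csc (th j) / L) ^+ 2.
  by apply: sumr_ge0 => j _; rewrite mulr_ge0 ?sqr_ge0 // ltW ?sin_theta_gt0.
have -> : \sum_j sin (th j) * (u j - csc (th j) / L) ^+ 2 =
    \sum_j sin (th j) * u j ^+ 2 - 2 / L * \sum_j u j
    + L ^- 2 * \sum_j csc (th j).
  rewrite !mulr_sumr -sumrB -big_split /=; apply: eq_bigr => j _.
  by have := sin_theta_gt0 j => s0; rewrite /csc; field; rewrite !gt_eqF.
(* The cosecants sum to Lambda, so the constant term is 1 / Lambda; as the sum of u is at least 1,
   the weighted sum of squares is at least 2 / Lambda - 1 / Lambda. *)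
have hu : 2 / L <= 2 / L * \sum_j u j by rewrite ler_peMr // divr_ge0 // ltW.
rewrite -[\sum_j csc _]/L expr2 invfM divfK ?gt_eqF //.
rewrite -[X in _ -> _ <= X]/(\sum_j sin (th j) * u j ^+ 2).
by move: hu; rewrite -[2 / L]/(2 * L^-1); lra.
Qed.

Lemma attained_residual y : hard_start y ->
  exists Q, [/\ (size Q <= K.+1)%N, Q.[1] = 1 & poly_residual y Q = 1 / L].
Proof.
move=> hy; have Lp := Lambda_gt0.
(* Discrete Fourier inversion of the interpolation conditions; c m.+1 is the
   coefficient of 'X^m, and cn below is the condition on the degree. *)
pose c m := n%:R^-1 * (1 - L^-1 * \sum_j csc (th j) * cos (th j *+ 2 *+ m)).
have cE m : C (c m) =
    n%:R^-1 * (1 - C L^-1 * \sum_j C (csc (th j)) * w ^+ (j.+1 * m)).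
  (* The reflection j -> n - j keeps csc and flips the sine, so the Fourier sum has no imaginary
     part and the coefficients are real. *)
  have s0 : \sum_j csc (th j) * sin (th j *+ 2 *+ m) = 0.
    suff : \sum_j csc (th j) * sin (th j *+ 2 *+ m)
        = - \sum_j csc (th j) * sin (th j *+ 2 *+ m) by lra.
    rewrite {1}(reindex_inj rev_ord_inj) -sumrN /=; apply: eq_bigr => j _.
    have [c1 s1] := cos_sin_2pin R m.
    rewrite csc_rev_ord rev_theta !mulrnBl sinB c1 s1.
    by rewrite mul0r sub0r mul1r mulrN.
  have -> : \sum_j C (csc (th j)) * w ^+ (j.+1 * m) =
      C (\sum_j csc (th j) * cos (th j *+ 2 *+ m)).
    transitivity (C (\sum_j csc (th j) * cos (th j *+ 2 *+ m)) +
        'i%C * C (\sum_j csc (th j) * sin (th j *+ 2 *+ m))).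
      rewrite !rmorph_sum mulr_sumr -big_split; apply: eq_bigr => j _ /=.
      by rewrite exprM omegaX cisX cisE !rmorphM /= mulrDr mulrCA.
    by rewrite s0 rmorph0 mulr0 addr0.
  by rewrite /c rmorphM rmorphB rmorph1 rmorphM fmorphV rmorph_nat.
have cn : c n = 0.
  apply: (@complexI R); rewrite cE rmorph0.
  have w1 := prim_expr_order (omega_prim R K).
  under eq_bigr do rewrite mulnC exprM w1 expr1n mulr1.
  by rewrite -rmorph_sum -rmorphM mulVf ?gt_eqF // rmorph1 subrr mulr0.
pose P := \poly_(m < N) c m.+1.
(* By orthogonality only k = 0 and k = -j modulo n contribute. *)
have PE k : (map_poly C P).[w ^+ k] = (n %| k)%N%:R
   - C L^-1 * \sum_j C (csc (th j)) * w ^+ j.+1 * (n %| j.+1 + k)%N%:R.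
  (* The vanishing [c n] lets the sum run over a full period of n terms. *)
  have -> : (map_poly C P).[w ^+ k] = \sum_(m < n) C (c m.+1) * w ^+ (m * k).
    rewrite (@horner_coef_wide _ N) ?size_map_poly ?size_poly //.
    rewrite [RHS]big_ord_recr /= cn rmorph0 mul0r addr0; apply: eq_bigr => m _.
    by rewrite coef_map coef_poly ltn_ord -exprM mulnC.
  have sE m : \sum_(i < n) w ^+ (i * m) = n%:R * (n %| m)%N%:R.
    by rewrite (sum_prim_root_expr (omega_prim R K)) mulr_natr mulrb.
  transitivity (n%:R^-1 * (\sum_(m < n) w ^+ (m * k) - C L^-1 *
      \sum_j C (csc (th j)) * w ^+ j.+1 * \sum_(m < n) w ^+ (m * (j.+1 + k)))).
    under eq_bigr do rewrite cE -mulrA mulrBl mul1r.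
    rewrite -mulr_sumr sumrB; congr (_ * (_ - _)).
    under eq_bigr do rewrite -mulrA.
    rewrite -mulr_sumr; congr (_ * _).
    under eq_bigr do rewrite mulr_suml.
    rewrite exchange_big; apply: eq_bigr => j _ /=.
    rewrite mulr_sumr; apply: eq_bigr => m _.
    by rewrite -!mulrA -!exprD; congr (_ * _ ^+ _); lia.
  have n0 : (n%:R : R[i]) != 0 by rewrite pnatr_eq0.
  rewrite sE mulrBr mulKf //; congr (_ - _); rewrite mulrCA; congr (_ * _).
  rewrite mulr_sumr; apply: eq_bigr => j _.
  by rewrite sE mulrCA; congr (_ * _); rewrite mulKf.
(* 2 t - 1 inverts t = (1 + z) / 2, so Q(zeta_j) = P(w^j). *)
pose Q := P \Po (2%:P * 'X + (-1)%:P).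
have Q1 : Q.[1] = 1.
  rewrite horner_comp_affine mulr1 addrK.
  apply: (@complexI R); rewrite -horner_map rmorph1 -(expr0 w) PE dvdn0.
  rewrite big1 ?mulr0 ?subr0 // => j _; rewrite addn0 gtnNdvd ?mulr0 //.
  by rewrite ltnS ltn_ord.
have QE j : normc (map_poly C Q).[zeta R j] = csc (th j) / L.
  have -> : (map_poly C Q).[zeta R j] = (map_poly C P).[w ^+ j.+1].
    rewrite map_comp_poly rmorphD rmorphM /= map_polyX !map_polyC /=.
    rewrite horner_comp_affine; congr _.[_].
    rewrite rmorphN rmorph1 rmorph_nat /zeta mulrC divfK ?pnatr_eq0 //.
    by rewrite addrAC subrr add0r.
  have nd : (n %| j.+1)%N = false by rewrite gtnNdvd // ltnS ltn_ord.
  rewrite PE nd /= sub0r normcN normcM.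
  (* Among indices in {1, ..., n - 1}, 0 < i + j < 2 n, so n divides i + j only for i = n - j. *)
  rewrite (bigD1 (rev_ord j)) //= big1 => [|i ij].
    have -> : ((K.+1 - j.+1).+1 + j.+1)%N = n by rewrite addSn subnK.
    rewrite dvdnn mulr1 addr0 normcM csc_rev_ord.
    rewrite (omegaX R (rev_ord j)) normc_cis mulr1 mulrC.
    rewrite /normc /= !expr0n /= !addr0.
    by rewrite !sqrtr_sqr !gtr0_norm ?csc_theta_gt0 ?invr_gt0.
  rewrite (_ : (n %| i.+1 + j.+1)%N = false) ?mulr0 //.
  apply/negP => /dvdnP[q e]; case/eqP: ij; apply: val_inj => /=.
  have := ltn_ord i; have := ltn_ord j.
  by case: q e => [|[|q]]; lia.
exists Q; split=> //.
  by rewrite size_comp_affine ?pnatr_eq0 ?size_poly.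
apply/eqP; rewrite -(@eqrXn2 _ 2) ?sqrtr_ge0 ?divr_ge0 ?ltW //.
rewrite /poly_residual (residual_sqr hy (zcoord_poly_op Q y)).
rewrite div1r expr2; apply/eqP; congr (_ * _).
have L0 := lt0r_neq0 Lp.
(* Each term is sin theta (csc theta / Lambda)^2 = csc theta / Lambda^2, and the sum is 1 /
   Lambda. *)
transitivity (L * L^-1 ^+ 2); last by rewrite expr2 mulVKf.
rewrite {1}/Lambda mulr_suml; apply: eq_bigr => j _; rewrite QE /csc.
by have := sin_theta_gt0 j => s0; field; rewrite L0 gt_eqF.
Qed.

End Minimax.

End ComplexCoordinates.

Theorem theorem4p11 (R : realType) :
  (forall (K : nat) (y0 : 'M[R]_(2, K.+1)), (1 <= K)%N -> hard_start y0 ->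
    [/\ (* normalization *)
        enorm y0 = 1 /\ dist_zeros (barrier R K) y0 = 1,
        (* (i) *)
        forall Q : {poly R}, Q.[1] = 1 -> (size Q <= K.+1)%N ->
          1 / Lambda R K <= poly_residual y0 Q,
        forall M : method 'M[R]_(2, K.+1),
          let J := resolvent (barrier R K) in
          1 / Lambda R K <= enorm (residual (barrier R K) (iterate M J y0 K)) &
        (* (ii) *)
        (exists Q : {poly R},
          [/\ (size Q <= K.+1)%N, Q.[1] = 1 & poly_residual y0 Q = 1 / Lambda R K])
        /\ is_minimum [set poly_residual y0 Q | Q in admissible R K]
             (1 / Lambda R K)])
  /\ (* (iii) *)
  (exists e : nat -> R, e @ \oo --> (0 : R) /\
    forall K : nat, (2 <= K)%N ->
      Lambda R K = (2 / pi + e K) * (K%:R * ln K%:R))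
  /\
  (exists e : nat -> R, e @ \oo --> (0 : R) /\
    forall (K : nat) (y0 : 'M[R]_(2, K.+1)) (M : method 'M[R]_(2, K.+1)),
      (2 <= K)%N -> hard_start y0 ->
      let J := resolvent (barrier R K) in
      (pi / 2 + e K) * (dist_zeros (barrier R K) y0 / (K%:R * ln K%:R))
        <= enorm (residual (barrier R K) (iterate M J y0 K))).
Proof.
have lower K (y0 : 'M[R]_(2, K.+1)) (M : method 'M[R]_(2, K.+1)) :
    hard_start y0 -> let J := resolvent (barrier R K) in
    1 / Lambda R K <= enorm (residual (barrier R K) (iterate M J y0 K)).
  by move=> hy; exact: (residual_lower_bound hy (krylov_iterate _ _ _)).
split=> [K y0 _ hy|].
  have lowerQ Q : Q.[1] = 1 -> (size Q <= K.+1)%N ->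
      1 / Lambda R K <= poly_residual y0 Q.
    move=> Q1 sQ; apply: (residual_lower_bound hy).
    exact: krylov_leq sQ (krylov_poly_op _ Q1).
  have att := attained_residual hy.
  split=> //; first by rewrite dist_zeros_barrier enorm_hard_start.
    by move=> M; exact: (lower K y0 M hy).
  split=> //; split=> [|_ [Q [sQ Q1] <-]]; last exact: lowerQ.
  by case: att => Q [sQ Q1 e]; exists Q.
have pi0 : (2 / pi : R) != 0 by rewrite gt_eqF // divr_gt0 // pi_gt0.
have KlnK_gt0 K : (2 <= K)%N -> 0 < K%:R * ln K%:R :> R.
  by move=> K2; rewrite mulr_gt0 ?ln_gt0 ?ltr1n // ltr0n ltnW.
have ratio := @cvg_Lambda_ratio R.
split.
  (* The ratio minus its limit, so that the identity is exact wherever K ln K > 0. *)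
  exists (fun K => Lambda R K / (K%:R * ln K%:R) - 2 / pi); split.
    by rewrite -(subrr (2 / pi)); apply: cvgB ratio (cvg_cst _).
  by move=> K K2; rewrite addrC subrK divfK // gt_eqF // KlnK_gt0.
(* Chosen so that the left-hand side is exactly 1 / Lambda, the distance to the zeros being 1. *)
exists (fun K => (Lambda R K / (K%:R * ln K%:R))^-1 - pi / 2); split.
  rewrite -(subrr (pi / 2)); apply: cvgB (cvg_cst _).
  by rewrite -[pi / 2]invf_div; exact: cvgV.
move=> K y0 M K2 hy /=.
rewrite addrC subrK dist_zeros_barrier enorm_hard_start //.
rewrite invf_div mulrC mulrA divfK ?gt_eqF ?KlnK_gt0 //.
exact: (lower K y0 M hy).
Qed.
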